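(* Let $q$ be a prime power (odd or even), and let $\alpha\in\mathbb{F}_q$ and $\beta,\bar\beta\in\mathbb{F}_{q^2}$ be as in the context. For any integers $m,n>0$, we have the identity of rational functions \[ C_{m+n}(x,\alpha)=H\bigl(C_m(x,\alpha),\,C_n(x,\alpha)\bigr) \] where \[ H(x,y):=\frac{x+y-(\beta+\bar\beta)xy}{1+\alpha xy}. \]
   Context: Let $q$ be a prime power and let $h(x)\in\mathbb{F}_q[x]$ be an irreducible polynomial of the form $x^2-\alpha$ if $q$ is odd, and $x^2+x+\alpha$ if $q$ is even. Let $\beta\in\mathbb{F}_{q^2}$ be a root of $h(x)$ and $\bar\beta:=\beta^q$ the other root (so $\beta+\bar\beta$ is $0$ for odd $q$ and $1$ for even $q$). Set $\rho(x):=(x-\bar\beta)/(x-\beta)$ and $\rho^{-1}(x):=(\beta x-\bar\beta)/(x-1)$, which are inverse under composition. The degree-$n$ Rédei function is $R_n(x,\alpha):=\rho^{-1}\circ x^n\circ\rho\in\mathbb{F}_q(x)$. For a positive integer $n$, the degree-$n$ tangent-Chebyshev rational function $C_n(x,\alpha)\in\mathbb{F}_q(x)$ is defined as follows. For odd $q$, \[ C_n(x,\alpha):=\frac{\sum_{i=0}^{\lfloor (n-1)/2\rfloor}\binom{n}{2i+1}\alpha^i x^{2i+1}}{\sum_{i=0}^{\lfloor n/2\rfloor}\binom{n}{2i}\alpha^i x^{2i}}. \] For even $q$, $C_n(x,\alpha):=\frac1x\circ R_n(x,\alpha)\circ\frac1x=1/R_n(1/x,\alpha)$. *)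

(* Defs.v *)
From mathcomp Require Export all_boot all_order all_algebra all_field.
From mathcomp Require Import generic_quotient.

Set Implicit Arguments.
Unset Strict Implicit.
Unset Printing Implicit Defensive.

Import GRing.Theory.
Local Open Scope ring_scope.

Notation ratfun K := {fraction {poly K}}.

Section RationalFunctions.
Variable K : fieldType.

Definition pfrac (p : {poly K}) : ratfun K := @FracField.tofrac {poly K} p.
Definition rconst (c : K) : ratfun K := pfrac c%:P.
Definition rX : ratfun K := pfrac 'X.

Definition peval (p : {poly K}) (g : ratfun K) : ratfun K :=
  (map_poly rconst p).[g].

(* f o g, computed from the lowest-terms form of f. By the convention        *)
(* x / 0 = 0 the value is 0 when g is a (constant) pole of f; the inner      *)
(* functions g used below are all nonconstant when n > 0.                    *)
Definition rcomp (f g : ratfun K) : ratfun K :=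
  let nd := frac (repr f) in
  let c := gcdp nd.1 nd.2 in
  peval (nd.1 %/ c) g / peval (nd.2 %/ c) g.

End RationalFunctions.

Arguments rX {K}.

Section TangentChebyshev.
Variables (F : finFieldType) (L : fieldExtType F).

Definition hpoly (alpha : F) : {poly F} :=
  if odd #|F| then 'X^2 - alpha%:P else 'X^2 + 'X + alpha%:P.

Definition conj_root (beta : L) : L := beta ^+ #|F|.

Definition rho (beta : L) : ratfun L :=
  (rX - rconst (conj_root beta)) / (rX - rconst beta).

Definition rho_inv (beta : L) : ratfun L :=
  (rconst beta * rX - rconst (conj_root beta)) / (rX - 1).

(* The parameter alpha of R_n(x, alpha) enters only through the chosen root  *)
(* beta of hpoly alpha.                                                      *)
Definition redei (beta : L) (n : nat) : ratfun L :=
  rcomp (rho_inv beta) (rcomp (rX ^+ n) (rho beta)).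

Definition tanch_num (alpha : F) (n : nat) : {poly F} :=
  \sum_(i < (n.-1)./2.+1)
     ('C(n, i.*2.+1)%:R * alpha ^+ i) *: 'X^(i.*2.+1).

Definition tanch_den (alpha : F) (n : nat) : {poly F} :=
  \sum_(i < n./2.+1) ('C(n, i.*2)%:R * alpha ^+ i) *: 'X^(i.*2).

Definition F_to_L (p : {poly F}) : {poly L} := map_poly (in_alg L) p.

(* C_n(x, alpha), viewed in L(x) along the inclusion of F(x) in L(x). *)
Definition tanch (alpha : F) (beta : L) (n : nat) : ratfun L :=
  if odd #|F| then
    pfrac (F_to_L (tanch_num alpha n)) / pfrac (F_to_L (tanch_den alpha n))
  else rcomp rX^-1 (rcomp (redei beta n) rX^-1).

Definition Hden (alpha : F) (u v : ratfun L) : ratfun L :=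
  1 + rconst alpha%:A * u * v.

Definition Hfun (alpha : F) (beta : L) (u v : ratfun L) : ratfun L :=
  (u + v - rconst (beta + conj_root beta) * u * v) / Hden alpha u v.

End TangentChebyshev.

(* Main.v *)
(* Odd q: numerator N_n and denominator D_n of C_n satisfy (Pascal's rule)
   N_{n+1} = N_n + x D_n and D_{n+1} = D_n + alpha x N_n, whence
   N_{m+n} = N_m D_n + D_m N_n and D_{m+n} = D_m D_n + alpha N_m N_n, which is
   the addition law divided by D_m D_n; here beta + conj beta = 0.

   Even q: with b = conj beta, p = (1 - b x)^n and q = (1 - beta x)^n, unfolding
   the compositions gives C_n = (p - q) / (beta p - b q).  As beta + b = 1,
   beta b = alpha and 2 = 0, this numerator and denominator satisfy the same kind
   of addition formulas, now with the extra term - N_m N_n in the numerator. *)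
From HB Require Import structures.
Require Import Defs.
From mathcomp Require Import generic_quotient zify ring.

Import GRing.Theory.
Local Open Scope ring_scope.

(** * Coefficients, recursions and addition formulas for the odd-case numerators and denominators *)

Lemma odd_half_doubleS k : odd k -> k = k./2.*2.+1.
Proof. by lia. Qed.

(** At most the summand with [i = k./2] contributes to degree [k]. No bound on [k] is required
    because the binomial coefficient vanishes beyond the summation range; Pascal's rule can then be
    applied coefficientwise. *)
Lemma coef_tanch_num (F : finFieldType) (alpha : F) n k :
  (tanch_num alpha n)`_k = if odd k then 'C(n, k)%:R * alpha ^+ k./2 else 0.
Proof.
rewrite coef_sum.
under eq_bigr do rewrite coefZ coefXn mulr_natr mulrb.
rewrite -big_mkcond /=; case: ifP => k_odd; last first.
  by rewrite big_pred0 // => i; apply/negbTE; lia.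
rewrite (eq_bigl (fun i : 'I__ => i == k./2 :> nat)); last by move=> i; lia.
rewrite (big_ord1_eq _ (fun i => 'C(n, i.*2.+1)%:R * alpha ^+ i)) -odd_half_doubleS //.
by case: ifP => // lt_k; rewrite bin_small ?mul0r //; lia.
Qed.

Lemma coef_tanch_den (F : finFieldType) (alpha : F) n k :
  (tanch_den alpha n)`_k = if odd k then 0 else 'C(n, k)%:R * alpha ^+ k./2.
Proof.
rewrite coef_sum.
under eq_bigr do rewrite coefZ coefXn mulr_natr mulrb.
rewrite -big_mkcond /=; case: ifP => k_odd.
  by rewrite big_pred0 // => i; apply/negbTE; lia.
rewrite (eq_bigl (fun i : 'I__ => i == k./2 :> nat)); last by move=> i; lia.
rewrite (big_ord1_eq _ (fun i => 'C(n, i.*2)%:R * alpha ^+ i)) even_halfK ?k_odd //.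
by case: ifP => // lt_k; rewrite bin_small ?mul0r //; lia.
Qed.

Lemma tanch_num0 (F : finFieldType) (alpha : F) : tanch_num alpha 0 = 0.
Proof. by apply/polyP => -[|k]; rewrite coef_tanch_num coef0 ?mul0r ?if_same. Qed.

Lemma tanch_den0 (F : finFieldType) (alpha : F) : tanch_den alpha 0 = 1.
Proof.
by apply/polyP => -[|k]; rewrite coef_tanch_den coef1 ?mulr1 ?mul0r ?if_same.
Qed.

Lemma tanch_numS (F : finFieldType) (alpha : F) n :
  tanch_num alpha n.+1 = tanch_num alpha n + 'X * tanch_den alpha n.
Proof.
apply/polyP => -[|k]; rewrite coefD coefXM !coef_tanch_num ?addr0 //=.
rewrite coef_tanch_den; case k_odd: (odd k) => /=; first by rewrite addr0.
by rewrite binS natrD mulrDl uphalf_half k_odd.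
Qed.

Lemma tanch_denS (F : finFieldType) (alpha : F) n :
  tanch_den alpha n.+1 = tanch_den alpha n + alpha *: ('X * tanch_num alpha n).
Proof.
apply/polyP => -[|k]; rewrite coefD coefZ coefXM !coef_tanch_den.
  by rewrite !bin0 mulr0 addr0.
rewrite coef_tanch_num /=; case k_odd: (odd k) => /=; last by rewrite mulr0 addr0.
by rewrite binS natrD uphalf_half k_odd add1n exprS; ring.
Qed.

Lemma tanch_num_den_add (F : finFieldType) (alpha : F) m n :
  tanch_num alpha (m + n) = tanch_num alpha m * tanch_den alpha n
                            + tanch_den alpha m * tanch_num alpha n /\
  tanch_den alpha (m + n) = tanch_den alpha m * tanch_den alpha n
                            + alpha *: (tanch_num alpha m * tanch_num alpha n).
Proof.
elim: n => [|n [IHn IHd]].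
  by rewrite addn0 tanch_num0 tanch_den0 !mulr0 scaler0 !addr0 !mulr1.
rewrite addnS !tanch_numS !tanch_denS IHn IHd -!mul_polyC; split; ring.
Qed.

(** The constant coefficient is 1, whatever [alpha] is. *)
Lemma tanch_den_neq0 (F : finFieldType) (alpha : F) n : tanch_den alpha n != 0.
Proof.
apply: contra_neq (oner_neq0 F) => d0.
by have := coef_tanch_den F alpha n 0; rewrite d0 coef0 bin0 mulr1.
Qed.

(** * Field identities behind the addition law *)

(** Serves both parities, with [s = 0] for odd q and [s = 1] for even q. Since
    [1 + a * u * v = D / (D1 * D2)], the nonvanishing of [D] gives that of the denominator of H. *)
Lemma tan_add_law (E : fieldType) (a s N1 D1 N2 D2 N D : E) :
    D1 != 0 -> D2 != 0 -> D != 0 ->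
    N = N1 * D2 + D1 * N2 - s * N1 * N2 -> D = D1 * D2 + a * N1 * N2 ->
  let u := N1 / D1 in let v := N2 / D2 in
  1 + a * u * v != 0 /\ N / D = (u + v - s * u * v) / (1 + a * u * v).
Proof.
move=> D1nz D2nz Dnz -> DE u v.
have D12 : 1 + a * u * v = D / (D1 * D2).
  by rewrite DE /u /v; field; rewrite D1nz D2nz.
have nz : 1 + a * u * v != 0 by rewrite D12 !mulf_neq0 ?invr_neq0 ?mulf_neq0.
split=> //; rewrite D12 /u /v.
by field; rewrite D1nz D2nz Dnz.
Qed.

(* The factor [1] stands for the parameter [s] of [tan_add_law]. *)
Lemma tan_param_char2 (E : fieldType) (a b p q p' q' : E) :
    2%:R = 0 :> E -> a + b = 1 ->
  (p * p' - q * q' = (p - q) * (a * p' - b * q') + (a * p - b * q) * (p' - q')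
                     - 1 * (p - q) * (p' - q')) /\
  (a * (p * p') - b * (q * q') = (a * p - b * q) * (a * p' - b * q')
                     + (a * b) * (p - q) * (p' - q')).
Proof.
move=> two0 ab1; have -> : b = 1 - a by rewrite -ab1 addrC addKr.
split; apply/eqP; rewrite eq_sym -subr_eq0; apply/eqP.
  (* The two sides differ by twice the displayed factor. *)
  rewrite -[RHS](mul0r ((a - 1) * (p * p') + (1 - a) * (q * q'))) -two0; ring.
rewrite -[RHS](mul0r ((1 - a) * (q * q') - a * (1 - a) * (p * q' + p' * q))) -two0; ring.
Qed.

Lemma homogenize_div (E : fieldType) (a b x y w : E) : w != 0 -> x - y != 0 ->
  (a * (x / w) - b * (y / w)) / (x / w - y / w) = (a * x - b * y) / (x - y).
Proof. by move=> w0 xy0; field; rewrite xy0. Qed.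

Lemma homogenize_div1 (E : fieldType) (a b x y : E) : y != 0 -> x - y != 0 ->
  (a * (x / y) - b) / (x / y - 1) = (a * x - b * y) / (x - y).
Proof. by move=> y0 xy0; field; rewrite y0 xy0. Qed.

Lemma divf_neq0 (E : fieldType) (x y : E) : x != 0 -> y != 0 -> x / y != 0.
Proof. by move=> x0 y0; rewrite mulf_neq0 ?invr_eq0. Qed.

Lemma divf_sub_neq0 (E : fieldType) (x y w : E) :
  w != 0 -> x - y != 0 -> x / w - y / w != 0.
Proof. by move=> w0 xy0; rewrite -mulrBl divf_neq0. Qed.

Lemma divf_sub1_neq0 (E : fieldType) (x y : E) :
  y != 0 -> x - y != 0 -> x / y - 1 != 0.
Proof. by move=> y0; rewrite -(divff y0); apply: divf_sub_neq0. Qed.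

Lemma divf_mul2l (E : fieldType) (e a b : E) : e * b != 0 -> e * a / (e * b) = a / b.
Proof. by rewrite mulf_eq0 negb_or => /andP[e0 _]; rewrite -mulf_div divff ?mul1r. Qed.

(** * Evaluation and composition of rational functions *)

Section RationalFunctions.
Variable K : fieldType.

Lemma fracE (f : ratfun K) :
  f = pfrac (frac (repr f)).1 / pfrac (frac (repr f)).2.
Proof.
set r := repr f; have dr : (frac r).2 != 0 := denom_ratioP r.
suff: f * pfrac (frac r).2 = pfrac (frac r).1.
  by move <-; rewrite mulfK // /pfrac tofrac_eq0.
(* Polynomials embed as ratios over 1, so the claim becomes the cross-multiplication relation that
   defines the quotient. *)
rewrite -[f]reprK -/r /pfrac; unlock FracField.tofrac.
rewrite -[LHS]FracField.pi_mul; apply/eqmodP; rewrite /= FracField.equivfE.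
by rewrite /FracField.mulf !numden_Ratio ?mulr1 ?oner_neq0 ?mul1r // mulrC.
Qed.

HB.instance Definition _ := GRing.RMorphism.copy (@pfrac K) (@FracField.tofrac {poly K}).
HB.instance Definition _ := GRing.RMorphism.copy (@rconst K) (@pfrac K \o polyC).

Lemma pfrac_eq0 (p : {poly K}) : (pfrac p == 0) = (p == 0).
Proof. exact: tofrac_eq0. Qed.

Lemma pevalB (p q : {poly K}) g : peval (p - q) g = peval p g - peval q g.
Proof. by rewrite /peval rmorphB hornerD hornerN. Qed.

Lemma pevalM (p q : {poly K}) g : peval (p * q) g = peval p g * peval q g.
Proof. by rewrite /peval rmorphM hornerM. Qed.

Lemma pevalXn (p : {poly K}) n g : peval (p ^+ n) g = peval p g ^+ n.
Proof. by rewrite /peval rmorphXn horner_exp. Qed.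

Lemma pevalC (c : K) g : peval c%:P g = rconst c.
Proof. by rewrite /peval map_polyC hornerC. Qed.

Lemma pevalX (g : ratfun K) : peval 'X g = g.
Proof. by rewrite /peval map_polyX hornerX. Qed.

(** After division by the gcd the two parts of [u / v] are coprime, so by Gauss's lemma the reduced
    denominator divides [q]; the quotient is [e]. *)
Lemma lowest_terms (p q u v : {poly K}) :
    v != 0 -> p * v = u * q ->
  exists e, p = e * (u %/ gcdp u v) /\ q = e * (v %/ gcdp u v).
Proof.
move=> v0 pv_uq; set c := gcdp u v.
have c0 : c != 0 by rewrite gcdp_eq0 negb_and v0 orbT.
set a := u %/ c; set b := v %/ c.
have Ea : u = a * c by rewrite divpK // dvdp_gcdl.
have Eb : v = b * c by rewrite divpK // dvdp_gcdr.
have pb_aq : p * b = a * q by apply: (mulIf c0); rewrite -mulrA -Eb pv_uq Ea mulrAC.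
have cop : coprimep b a.
  by rewrite coprimep_sym; apply: coprimep_div_gcd; rewrite v0 orbT.
have /dvdpP[e qE] : b %| q by rewrite -(Gauss_dvdpr _ cop) -pb_aq dvdp_mull.
have b0 : b != 0 by apply: contraNneq v0 => b0; rewrite Eb b0 mul0r.
by exists e; split=> //; apply: (mulIf b0); rewrite pb_aq qE mulrCA mulrA.
Qed.

(** The common factor relating [p / q] to its lowest terms does not vanish at [g], because it
    divides [q]; hence it cancels after evaluation. *)
Lemma peval_lowest (p q u v : {poly K}) (g : ratfun K) :
    v != 0 -> p * v = u * q -> peval q g != 0 ->
  peval (u %/ gcdp u v) g / peval (v %/ gcdp u v) g = peval p g / peval q g.
Proof.
move=> v0 /lowest_terms[] // e [-> ->]; rewrite !pevalM => e0.
by rewrite divf_mul2l.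
Qed.

Lemma pfrac_div_eq (p q u v : {poly K}) :
  q != 0 -> v != 0 -> pfrac p / pfrac q = pfrac u / pfrac v -> p * v = u * q.
Proof.
move=> q0 v0 /eqP; rewrite eqr_div ?pfrac_eq0 // -!rmorphM -subr_eq0 -rmorphB.
by rewrite pfrac_eq0 subr_eq0 => /eqP.
Qed.

(* Any representation p / q may be used, not only the lowest-terms one, as long
   as its denominator does not vanish at g. *)
Lemma rcomp_div (p q : {poly K}) (g : ratfun K) :
  peval q g != 0 -> rcomp (pfrac p / pfrac q) g = peval p g / peval q g.
Proof.
move=> qg; apply: peval_lowest => //; first exact: denom_ratioP.
apply: pfrac_div_eq; first by apply: contraNneq qg => ->; rewrite /peval rmorph0 horner0.
- exact: denom_ratioP.
- exact: fracE.
Qed.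

Lemma peval_subX_exp (c : K) n (g : ratfun K) :
  peval (('X - c%:P) ^+ n) g = (g - rconst c) ^+ n.
Proof. by rewrite pevalXn pevalB pevalX pevalC. Qed.

Lemma pfracX_sub (c : K) : pfrac ('X - c%:P) = rX - rconst c.
Proof. by rewrite rmorphB. Qed.

Lemma rcomp_rXn n (g : ratfun K) : rcomp (rX ^+ n) g = g ^+ n.
Proof.
have := rcomp_div ('X^n) 1%:P g; rewrite pevalXn pevalX pevalC.
by rewrite rmorphXn /= -/(rconst 1) !rmorph1 !divr1 => -> //; rewrite oner_neq0.
Qed.

Lemma rcomp_rXV (g : ratfun K) : g != 0 -> rcomp rX^-1 g = g^-1.
Proof.
move=> g0; have := rcomp_div 1%:P 'X g; rewrite pevalX pevalC.
by rewrite -/(rconst 1) !rmorph1 !div1r => ->.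
Qed.

Lemma rX_neq0 : rX != 0 :> ratfun K.
Proof. by rewrite pfrac_eq0 polyX_eq0. Qed.

(** Gives the nonvanishing of the differences of n-th powers that occur as denominators when the
    compositions are unfolded. *)
Lemma exp_lin_neq (c0 c1 d0 d1 : K) n (x : K) (a b : K) :
    (0 < n)%N -> c0 + c1 * x = 0 -> d0 + d1 * x != 0 -> b != 0 ->
  rconst a * (rconst c0 + rconst c1 * rX) ^+ n
    - rconst b * (rconst d0 + rconst d1 * rX) ^+ n != 0.
Proof.
move=> n_gt0 c_root d_nz b_nz.
have -> : rconst a * (rconst c0 + rconst c1 * rX) ^+ n
          - rconst b * (rconst d0 + rconst d1 * rX) ^+ n =
    pfrac (a%:P * (c0%:P + c1%:P * 'X) ^+ n - b%:P * (d0%:P + d1%:P * 'X) ^+ n).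
  by rewrite rmorphB !rmorphM !rmorphXn !rmorphD !rmorphM.
(* At x only the second power survives. *)
rewrite pfrac_eq0; apply/negP => /eqP /(congr1 (horner^~ x)) /eqP.
rewrite !hornerE c_root expr0n gtn_eqF // mulr0 sub0r oppr_eq0.
by rewrite mulf_eq0 (negbTE b_nz) expf_eq0 (negbTE d_nz) andbF.
Qed.
End RationalFunctions.

(** * The conjugate root: sum and product of the roots of h *)

Section ConjugateRoot.
Variables (F : finFieldType) (L : fieldExtType F).

(** The order q is a power of the characteristic, which makes the q-th power map additive on [L]. *)
Lemma pnat_card_finField : [pchar L].-nat #|F|.
Proof.
have [p p_pr pchF] := finPcharP F.
have -> : #|F| = (p ^ logn p #|F|)%N := card_pprimeChar pchF.
by rewrite pnatX pnatE // (pchar_lalg L) pchF.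
Qed.

Lemma pchar2_even_card : ~~ odd #|F| -> 2%N \in [pchar L].
Proof.
have [p p_pr pchF] := finPcharP F.
rewrite (card_pprimeChar pchF : #|F| = (p ^ _)%N) oddX negb_or => /andP[_].
by case: (even_prime p_pr) => [p2|->//]; rewrite (pchar_lalg L) -p2 pchF.
Qed.

Lemma exp_card_alg (a : F) : a%:A ^+ #|F| = a%:A :> L.
Proof. by rewrite -[a%:A]/(in_alg L a) -rmorphXn expf_card. Qed.

(** Over [F], $X^q - X$ is the product of all $X - a$ with $a \in F$; mapped to [L], it vanishes at
    [beta], so one of the factors does. *)
Lemma conj_root_fixed (beta : L) :
  conj_root beta = beta -> exists a : F, beta = a%:A.
Proof.
move=> fix_beta; have := congr1 (map_poly (in_alg L)) (finField_genPoly F).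
rewrite rmorphB /= map_polyXn map_polyX rmorph_prod => /(congr1 (horner^~ beta)).
rewrite !hornerE [beta ^+ _]fix_beta subrr horner_prod => /esym/eqP.
rewrite prodf_seq_eq0 => /hasP[a _]; rewrite rmorphB /= map_polyX map_polyC.
by rewrite hornerXsubC subr_eq0 => /eqP ->; exists a.
Qed.

Lemma size_hpoly (alpha : F) : size (hpoly alpha) = 3.
Proof.
rewrite /hpoly; case: ifP => _; first by rewrite size_XnsubC.
by rewrite -addrA size_polyDl size_polyXn // size_XaddC.
Qed.

Lemma hpoly_rootE (alpha : F) (beta : L) :
  root (F_to_L L (hpoly alpha)) beta ->
  if odd #|F| then beta ^+ 2 = alpha%:A else beta ^+ 2 + beta + alpha%:A = 0.
Proof.
rewrite /root /F_to_L /hpoly; case: ifP => _.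
  by rewrite rmorphB /= map_polyXn map_polyC !hornerE subr_eq0 => /eqP.
by rewrite !rmorphD /= map_polyXn map_polyX map_polyC !hornerE => /eqP.
Qed.

(** A fixed [beta] would lie in [F] and give the irreducible quadratic h a linear factor. *)
Lemma conj_root_neq (alpha : F) (beta : L) :
    irreducible_poly (hpoly alpha) -> root (F_to_L L (hpoly alpha)) beta ->
  conj_root beta != beta.
Proof.
move=> irr_h root_h; apply/eqP => /conj_root_fixed[a beta_a].
have := root_h; rewrite beta_a (fmorph_root (in_alg L)) root_factor_theorem.
move/(apply_irredp irr_h); rewrite size_XsubC => /(_ isT)/eqp_size.
by rewrite size_XsubC size_hpoly.
Qed.

(** The conjugate has square $\alpha^q = \alpha = \beta^2$, so it is $\pm\beta$, and the plus sign
    is excluded. *)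
Lemma conj_root_odd (alpha : F) (beta : L) :
    odd #|F| -> irreducible_poly (hpoly alpha) ->
    root (F_to_L L (hpoly alpha)) beta ->
  beta + conj_root beta = 0.
Proof.
move=> q_odd irr_h root_h; have := hpoly_rootE _ _ root_h; rewrite q_odd => sqr_beta.
have : conj_root beta ^+ 2 == beta ^+ 2.
  by rewrite /conj_root exprAC sqr_beta exp_card_alg.
rewrite eqf_sqr (negbTE (conj_root_neq _ _ irr_h root_h)) => /eqP ->.
exact: subrr.
Qed.

Lemma conj_root_even (alpha : F) (beta : L) :
    ~~ odd #|F| -> irreducible_poly (hpoly alpha) ->
    root (F_to_L L (hpoly alpha)) beta ->
  beta + conj_root beta = 1 /\ beta * conj_root beta = alpha%:A.
Proof.
move=> q_even irr_h root_h; have := hpoly_rootE _ _ root_h.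
rewrite (negbTE q_even) => h_beta; have ch2 := pchar2_even_card q_even.
(* Raising the equation of [beta] to the q-th power shows that the conjugate is a root too. *)
have h_conj : conj_root beta ^+ 2 + conj_root beta + alpha%:A = 0.
  rewrite /conj_root exprAC -(exp_card_alg alpha) -!exprDn_pchar ?pnat_card_finField //.
  by rewrite h_beta expr0n gtn_eqF //; apply/card_gt0P; exists 0.
have sum1 : beta + conj_root beta = 1.
  apply/eqP; rewrite -subr_eq0 (oppr_pchar2 ch2).
  (* Subtracting the two root equations gives $(\bar\beta - \beta)(\beta + \bar\beta + 1) = 0$, and
     the first factor is nonzero. *)
  have /mulfI : conj_root beta - beta != 0 by rewrite subr_eq0 (conj_root_neq _ _ irr_h).
  move=> inj; apply/eqP/inj; rewrite mulr0 -(subrr 0) -{1}h_conj -h_beta; ring.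
split=> //; have -> : conj_root beta = 1 + beta.
  by rewrite -sum1 addrAC (addrr_pchar2 ch2) add0r.
apply/eqP; rewrite -subr_eq0 (oppr_pchar2 ch2) -h_beta; apply/eqP; ring.
Qed.
End ConjugateRoot.

(** * Closed forms of the compositions and the addition law over a general field *)

Section TangentChebyshevAddition.
Variable K : fieldType.
Implicit Types beta b : K.

(* [redei] and the even case of [tanch], with an arbitrary pair (beta, b) in
   place of (beta, conj_root beta) and no reference to a base field. *)
Definition field_redei beta b n : ratfun K :=
  rcomp ((rconst beta * rX - rconst b) / (rX - 1))
        (rcomp (rX ^+ n) ((rX - rconst b) / (rX - rconst beta))).

Definition field_tanch beta b n : ratfun K :=
  rcomp rX^-1 (rcomp (field_redei beta b n) rX^-1).

Lemma field_redeiE beta b n :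
    (0 < n)%N -> b != beta ->
  field_redei beta b n =
    pfrac (beta%:P * ('X - b%:P) ^+ n - b%:P * ('X - beta%:P) ^+ n)
    / pfrac (('X - b%:P) ^+ n - ('X - beta%:P) ^+ n).
Proof.
move=> n_gt0 neq; set x := (rX - rconst b) ^+ n; set y := (rX - rconst beta) ^+ n.
have xy0 : x - y != 0.
  (* Evaluation at [b] kills [x] but not [y], since [b != beta]. *)
  have := exp_lin_neq _ (- b) 1 (- beta) 1 n b 1 1 n_gt0.
  rewrite !rmorph1 !mul1r addNr [- beta + _]addrC subr_eq0 oner_neq0.
  by rewrite !rmorphN ![- rconst _ + _]addrC; apply.
have y0 : y != 0 by apply: expf_neq0; rewrite -pfracX_sub pfrac_eq0 polyXsubC_eq0.
have -> : field_redei beta b n =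
    rcomp (pfrac (beta%:P * 'X - b%:P) / pfrac ('X - 1%:P)) (x / y).
  rewrite /field_redei rcomp_rXn expr_div_n !pfracX_sub rmorph1.
  by rewrite rmorphB rmorphM.
have xy1 := divf_sub1_neq0 _ _ _ y0 xy0.
rewrite rcomp_div !(pevalB, pevalM, pevalC, pevalX) rmorph1; last exact: xy1.
rewrite (homogenize_div1 _ _ _ _ _ y0 xy0).
by rewrite !rmorphB !rmorphM !rmorphXn !rmorphB.
Qed.

(** Substituting 1/x into the closed form of the Rédei function puts $x^n$ under each power; these
    cancel, and the outer inversion swaps numerator and denominator. *)
Lemma field_tanchE beta b n :
    beta != 0 -> b != 0 -> b != beta -> (0 < n)%N ->
  let p := (1 - rconst b * rX) ^+ n in
  let q := (1 - rconst beta * rX) ^+ n in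
  rconst beta * p - rconst b * q != 0 /\
  field_tanch beta b n = (p - q) / (rconst beta * p - rconst b * q).
Proof.
move=> beta0 b0 neq n_gt0 p q.
have lin_neq c d : d != 0 -> rconst c * p - rconst d * q != 0.
  (* The witness [b^-1] is the root of $1 - bx$, where $1 - \beta x$ is nonzero because
     [b != beta]. *)
  move=> d0; have := exp_lin_neq _ 1 (- b) 1 (- beta) n b^-1 c d n_gt0.
  rewrite !rmorph1 !rmorphN !mulNr; apply=> //; first by rewrite divff ?subrr.
  by rewrite subr_eq0 -(inj_eq (mulIf b0)) mul1r divfK.
have D0 := lin_neq beta b b0; split=> //.
have pq0 : p - q != 0.
  by have := lin_neq 1 1 (oner_neq0 _); rewrite !rmorph1 !mul1r.
have X0 : rX ^+ n != 0 :> ratfun K by rewrite expf_neq0 ?rX_neq0.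
have invX c : (rX^-1 - rconst c) ^+ n = (1 - rconst c * rX) ^+ n / rX ^+ n.
  by rewrite -expr_div_n mulrBl mul1r mulfK ?rX_neq0.
have RE : rcomp (field_redei beta b n) rX^-1 = (rconst beta * p - rconst b * q) / (p - q).
  rewrite field_redeiE // rcomp_div !(pevalB, pevalM, pevalC, peval_subX_exp) !invX.
    exact: homogenize_div X0 pq0.
  exact: divf_sub_neq0 X0 pq0.
by rewrite /field_tanch RE (rcomp_rXV _ _ (divf_neq0 _ _ _ D0 pq0)) invf_div.
Qed.

Lemma field_tanch_add beta b m n :
    2%:R = 0 :> K -> beta != 0 -> b != 0 -> b != beta -> beta + b = 1 ->
    (0 < m)%N -> (0 < n)%N ->
  let u := field_tanch beta b m in let v := field_tanch beta b n in
  1 + rconst (beta * b) * u * v != 0 /\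
  field_tanch beta b (m + n)
    = (u + v - rconst (beta + b) * u * v) / (1 + rconst (beta * b) * u * v).
Proof.
move=> two0 beta0 b0 neq sum1 m_gt0 n_gt0.
have mn_gt0 : (0 < m + n)%N by rewrite addn_gt0 m_gt0.
have tanchE k := field_tanchE beta b k beta0 b0 neq.
have [Dm ->] := tanchE m m_gt0; have [Dn ->] := tanchE n n_gt0.
have [Dmn ->] := tanchE (m + n)%N mn_gt0.
have two0K : 2%:R = 0 :> ratfun K by rewrite -(rmorph_nat (@rconst K)) two0 rmorph0.
have rsum1 : rconst beta + rconst b = 1 by rewrite -rmorphD sum1 rmorph1.
(* The coefficient [beta + b] becomes the parameter 1, and the powers for [m + n] split into the
   products that the characteristic 2 identities expect. *)
rewrite sum1 rmorph1 rmorphM; rewrite !exprD in Dmn *.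
have [numE denE] := tan_param_char2 _ _ _ ((1 - rconst b * rX) ^+ m)
  ((1 - rconst beta * rX) ^+ m) ((1 - rconst b * rX) ^+ n)
  ((1 - rconst beta * rX) ^+ n) two0K rsum1.
exact: (tan_add_law _ _ _ _ _ _ _ _ _ Dm Dn Dmn numE denE).
Qed.

(** The odd case, where [s = 0]. The term in [rconst 0] is kept so that the formula matches H once
    [beta + conj_root beta] is rewritten to 0. *)
Lemma pfrac_add_law (a : K) (N1 D1 N2 D2 : {poly K}) :
    D1 != 0 -> D2 != 0 -> D1 * D2 + a%:P * N1 * N2 != 0 ->
  let u := pfrac N1 / pfrac D1 in let v := pfrac N2 / pfrac D2 in
  1 + rconst a * u * v != 0 /\
  pfrac (N1 * D2 + D1 * N2) / pfrac (D1 * D2 + a%:P * N1 * N2)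
    = (u + v - rconst 0 * u * v) / (1 + rconst a * u * v).
Proof.
rewrite -!(pfrac_eq0 K) => D1nz D2nz Dnz.
apply: (tan_add_law _ _ _ _ _ _ _ _ _ D1nz D2nz Dnz).
  by rewrite rmorph0 !mul0r subr0 rmorphD !rmorphM.
by rewrite rmorphD !rmorphM.
Qed.
End TangentChebyshevAddition.

Theorem proposition3p9 (F : finFieldType) (L : fieldExtType F)
    (dimL : \dim (fullv : {vspace L}) = 2%N)
    (alpha : F) (irr_h : irreducible_poly (hpoly alpha))
    (beta : L) (root_h : root (F_to_L L (hpoly alpha)) beta)
    (m n : nat) (m_gt0 : (0 < m)%N) (n_gt0 : (0 < n)%N) :
  let Cm := tanch alpha beta m in
  let Cn := tanch alpha beta n in
  Hden alpha Cm Cn != 0 /\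
  tanch alpha beta (m + n) = Hfun alpha beta Cm Cn.
Proof.
case q_odd: (odd #|F|); last first.
  have q_even : ~~ odd #|F| by rewrite q_odd.
  have conj_neq := conj_root_neq _ _ _ _ irr_h root_h.
  have [sum1 prod_alpha] := conj_root_even _ _ _ _ q_even irr_h root_h.
  have beta_neq0 : beta != 0.
    (* If [beta] were 0, its q-th power would also be 0, contradicting the distinctness of the
       roots. *)
    apply: contra_neq conj_neq => ->; rewrite /conj_root expr0n gtn_eqF //.
    by apply/card_gt0P; exists 0.
  have conj_neq0 : conj_root beta != 0 by rewrite expf_neq0.
  (* Writing [alpha] as the product of the roots removes the base field from the goal, leaving the
     general law with [b] equal to the conjugate root. *)
  rewrite /Hfun /Hden /tanch q_odd -prod_alpha.
  apply: field_tanch_add => //; exact: pcharf0 (pchar2_even_card _ _ q_even).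
rewrite /Hfun /Hden /tanch q_odd (conj_root_odd _ _ _ _ q_odd irr_h root_h).
have den_neq0 k : F_to_L L (tanch_den alpha k) != 0.
  by rewrite map_poly_eq0 tanch_den_neq0.
(* The addition formulas over [F] are transported to [L] along the inclusion of coefficients. *)
have [num_add den_add] := tanch_num_den_add _ alpha m n.
have -> : F_to_L L (tanch_num alpha (m + n)) =
    F_to_L L (tanch_num alpha m) * F_to_L L (tanch_den alpha n)
    + F_to_L L (tanch_den alpha m) * F_to_L L (tanch_num alpha n).
  by rewrite num_add /F_to_L !(rmorphD, rmorphM).
have denE : F_to_L L (tanch_den alpha (m + n)) =
    F_to_L L (tanch_den alpha m) * F_to_L L (tanch_den alpha n)
    + (alpha%:A)%:P * F_to_L L (tanch_num alpha m) * F_to_L L (tanch_num alpha n).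
  by rewrite den_add -mul_polyC /F_to_L !(rmorphD, rmorphM) /= map_polyC mulrA.
rewrite denE; apply: pfrac_add_law; rewrite -?denE; exact: den_neq0.
Qed.
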